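(* The function $Z:\mathbb{R}\to\mathbb{R}$ defined by $$Z(\delta)=\max_{x\in\mathbb{Z}}\ \big[g(\delta+a_s x)-\rho_s(k)(x-k)-g(ka_s)\big]$$ is subadditive on $\mathbb{R}$; that is, $Z(\delta_1)+Z(\delta_2)\ge Z(\delta_1+\delta_2)$ for all $\delta_1,\delta_2\in\mathbb{R}$.
   Context: Let $n\ge 1$, let $f:\mathbb{R}\to\mathbb{R}$ be concave, let $a\in\mathbb{R}^n$ with $a_i\ge 0$ for all $i$, and let $\mu\in\mathbb{Z}^n$ with all $\mu_i\ge 1$. Fix $s\in\{1,\dots,n\}$ with $a_s>0$, disjoint subsets $S_0,S_1$ of $\{1,\dots,n\}\setminus\{s\}$ with $\{s\}\cup S_0\cup S_1=\{1,\dots,n\}$, and an integer $k\in\{1,\dots,\mu_s\}$. Define $g(z)=f\big(z+\sum_{i\in S_1}\mu_i a_i\big)$ and $\rho_s(k)=g(ka_s)-g((k-1)a_s)$. The maximum defining $Z$ is attained, and $Z$ has the closed form $Z(\delta)=g(\delta+(k-\ell-1)a_s)+(\ell+1)\rho_s(k)-g(ka_s)$ if $\ell a_s\le\delta<(\ell+1)a_s$, $\ell\in\mathbb{Z}$. *)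

(* Defs.v *)
From HB Require Import structures.
From mathcomp Require Import all_boot all_order all_algebra.
From mathcomp Require Import all_classical all_reals all_analysis.

Set Implicit Arguments.
Unset Strict Implicit.
Unset Printing Implicit Defensive.

Import Order.TTheory GRing.Theory Num.Theory.

Local Open Scope classical_set_scope.
Local Open Scope ring_scope.
Local Open Scope convex_scope.

(* [convex_function] of mathcomp.analysis.convex with the inequality reversed. *)
Definition concave_function (R : numFieldType) (E : lmodType R)
    (E' := convex_lmodType E) (D : set E') (f : E' -> R^o) : Prop :=
  forall t : {i01 R},
    {in D &, forall x y : E', (f x <| t |> f y <= f (x <| t |> y))%R}.

(* At most one element, the greatest one; compare [supremums]. *)
Definition maximums (R : realType) (A : set R) : set R := A `&` ubound A.

(* The default 0 is returned when [A] has no greatest element. *)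
Definition maximum (R : realType) (A : set R) : R := xget 0 (maximums A).

Section LiftingFunction.
Variables (R : realType) (n : nat) (f : R -> R).
Variables (a : 'rV[R]_n) (mu : 'rV[int]_n) (s : 'I_n) (S1 : {set 'I_n}).

Definition g (z : R) : R := f (z + \sum_(i in S1) (mu 0 i)%:~R * a 0 i).

Definition rho (k : int) : R :=
  g (k%:~R * a 0 s) - g ((k - 1)%:~R * a 0 s).

Definition Z_values (k : int) (delta : R) : set R :=
  [set g (delta + a 0 s * x%:~R) - rho k * (x - k)%:~R - g (k%:~R * a 0 s)
    | x in [set: int]].

Definition Z (k : int) (delta : R) : R := maximum (Z_values k delta).

End LiftingFunction.

(* Main.v *)
(* Put A = a_s and c = (k-1) A, and subtract from y |-> g (c + y) its chord over
   [0, A]. The result phi is concave and vanishes at 0 and A, hence it is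
   nonnegative on [0, A] and nonpositive elsewhere, and Z delta is a linear
   function of delta plus the maximum of phi over its class mod A. That maximum is
   attained at the representative of delta in [0, A), and a sum of two such
   representatives is reduced by subtracting 0 or A; in the first case
   phi (u + v) <= phi u + phi v because phi is concave with phi 0 = 0, and the
   second case is the first one for y |-> phi (A - y). *)

Require Import Defs.
From mathcomp Require Import all_boot all_order all_algebra.
From mathcomp Require Import all_classical all_reals all_analysis.
From mathcomp Require Import zify ring lra.

Import Order.TTheory GRing.Theory Num.Theory.

Local Open Scope ring_scope.

Section Chords.
Context {R : realType}.

(** Concavity with denominators cleared: the case [x = z] is harmless, and the division-free form
    suits [lra]. *)
Definition above_chords (F : R -> R) : Prop :=
  forall x y z : R, x <= y -> y <= z ->
    (z - y) * F x + (y - x) * F z <= (z - x) * F y.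

Lemma concave_above_chords (F : R -> R) :
  concave_function [set: R^o]%classic F -> above_chords F.
Proof.
move=> Fconc x y z xy yz.
have [xz|zx] := ltP x z; last first.
  have -> : y = x by lra.
  by have -> : z = x; lra.
have zx0 : 0 < z - x by lra.
have t0 : 0 <= (z - y) / (z - x) by rewrite divr_ge0//; lra.
have t1 : (z - y) / (z - x) <= 1 by rewrite ler_pdivrMr//; lra.
set t := (z - y) / (z - x) in t0 t1.
(* This is the concavity hypothesis up to conversion, with weight [t] on the left point [x]. *)
have : t * F x + (1 - t) * F z <= F (t * x + (1 - t) * z) :=
  Fconc (Itv01 t0 t1) x z (mem_set I) (mem_set I).
have -> : t * x + (1 - t) * z = y by rewrite /t; field; lra.
move=> /(ler_wpM2l (ltW zx0)); apply: le_trans.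
by rewrite le_eqVlt; apply/orP; left; apply/eqP; rewrite /t; field; lra.
Qed.

Lemma above_chords_shift (F : R -> R) (c : R) :
  above_chords F -> above_chords (fun y => F (c + y)).
Proof.
move=> Fch x y z xy yz.
have := Fch (c + x) (c + y) (c + z); rewrite !lerD2l => /(_ xy yz); lra.
Qed.

Lemma above_chords_reflect (F : R -> R) (c : R) :
  above_chords F -> above_chords (fun y => F (c - y)).
Proof.
move=> Fch x y z xy yz.
have := Fch (c - z) (c - y) (c - x); rewrite !lerD2l !lerN2 => /(_ yz xy); lra.
Qed.

Lemma above_chords_sub_affine (F : R -> R) (b r : R) :
  above_chords F -> above_chords (fun y => F y - b - r * y).
Proof. by move=> Fch x y z xy yz; have := Fch x y z xy yz; lra. Qed.

(** Both [u] and [v] lie in [[0, u + v]]; the two chord inequalities there add up to the claim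
    multiplied by [u + v]. *)
Lemma above_chords_subadditive (phi : R -> R) (u v : R) :
  above_chords phi -> phi 0 = 0 -> 0 <= u -> 0 <= v ->
  phi (u + v) <= phi u + phi v.
Proof.
move=> ch phi0 u0 v0.
have := ch 0 u (u + v) u0; rewrite lerDl => /(_ v0).
have := ch 0 v (u + v) v0; rewrite lerDr => /(_ u0).
rewrite phi0 => ? ?.
have [uv0|] := ltP 0 (u + v); first by rewrite -(ler_pM2l uv0); lra.
move=> uv; have -> : u = 0 by lra.
by have -> : v = 0; [lra | rewrite addr0 phi0 addr0].
Qed.

Section TwoZeros.
Context (phi : R -> R) (A : R).
Hypotheses (ch : above_chords phi) (A0 : 0 < A).
Hypotheses (phi0 : phi 0 = 0) (phiA : phi A = 0).

Lemma above_chords_ge0 (u : R) : 0 <= u -> u <= A -> 0 <= phi u.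
Proof.
move=> u0 uA; have := ch 0 u A u0 uA; rewrite phi0 phiA => h.
by rewrite -(ler_pM2l A0); lra.
Qed.

(** A positive value at [y] would lift the chord from [0] to [y] above the zero at [A]. *)
Lemma above_chords_le0r (y : R) : A <= y -> phi y <= 0.
Proof.
move=> Ay; have := ch 0 A y (ltW A0) Ay; rewrite phi0 phiA => h.
by rewrite -(ler_pM2l A0); lra.
Qed.

Lemma above_chords_le0l (y : R) : y <= 0 -> phi y <= 0.
Proof.
move=> y0; have := ch y 0 A y0 (ltW A0); rewrite phi0 phiA => h.
by rewrite -(ler_pM2l A0); lra.
Qed.

(** A nonzero [m] moves [u] out of the open interval from [0] to [A], hence to a point where [phi]
    is nonpositive, while [phi u] is nonnegative. *)
Lemma translate_le_representative (u : R) (m : int) :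
  0 <= u -> u < A -> phi (u + m%:~R * A) <= phi u.
Proof.
move=> u0 uA; have phiu := above_chords_ge0 _ u0 (ltW uA).
have [m_lt0|m_gt0|->] := ltgtP m 0; last by rewrite mul0r addr0.
- apply: le_trans phiu; apply: above_chords_le0l.
  have : m%:~R <= (-1)%:~R :> R by rewrite ler_int; lia.
  by rewrite mulrNz => ?; nra.
- apply: le_trans phiu; apply: above_chords_le0r.
  have : 1 <= m%:~R :> R by rewrite ler1z; lia.
  by nra.
Qed.

Lemma translate_subadditive (u v : R) (m : int) :
  0 <= u -> u < A -> 0 <= v -> v < A ->
  phi (u + v + m%:~R * A) <= phi u + phi v.
Proof.
move=> u0 uA v0 vA; have [uvA|Auv] := ltP (u + v) A.
  apply: le_trans (above_chords_subadditive _ _ _ ch phi0 u0 v0).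
  by apply: translate_le_representative => //; lra.
(* Now [u + v - A] is the representative in [[0, A)], so one period moves into the integer
   factor. *)
have -> : u + v + m%:~R * A = (u + v - A) + (m + 1)%:~R * A.
  by rewrite intrD; ring.
apply: (@le_trans _ _ (phi (u + v - A))).
  by apply: translate_le_representative; lra.
have psi0 : phi (A - 0) = 0 by rewrite subr0.
have Au : 0 <= A - u by lra.
have Av : 0 <= A - v by lra.
have := above_chords_subadditive _ _ _ (above_chords_reflect _ A ch) psi0 Au Av.
by rewrite !subKr; have -> : A - (A - u + (A - v)) = u + v - A by ring.
Qed.

End TwoZeros.
End Chords.

Theorem proposition3p2 (R : realType) (n : nat) (f : R -> R)
    (a : 'rV[R]_n) (mu : 'rV[int]_n) (s : 'I_n) (S0 S1 : {set 'I_n}) (k : int)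
    (n_ge1 : (1 <= n)%N)
    (f_concave : concave_function [set: R^o]%classic f)
    (a_ge0 : forall i : 'I_n, 0 <= a 0 i)
    (mu_ge1 : forall i : 'I_n, 1 <= mu 0 i)
    (as_gt0 : 0 < a 0 s)
    (sNS0 : s \notin S0) (sNS1 : s \notin S1)
    (S0S1_disjoint : [disjoint S0 & S1])
    (S_cover : (s |: (S0 :|: S1))%SET = [set: 'I_n]%SET)
    (k_ge1 : 1 <= k) (k_le_mu : k <= mu 0 s) :
  (forall delta : R,
     maximums (Z_values f a mu s S1 k delta) (Z f a mu s S1 k delta)) /\
  (forall delta1 delta2 : R,
     Z f a mu s S1 k delta1 + Z f a mu s S1 k delta2
       >= Z f a mu s S1 k (delta1 + delta2)).
Proof.
set A := a 0 s; pose r := rho f a mu s S1 k; pose c := (k - 1)%:~R * A.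
(* [r] is the increase of [G] from [c] to [c + A], so [r / A] is the slope of the chord. *)
pose G := g f a mu S1; pose phi y := G (c + y) - G c - r / A * y.
have A_neq0 : A != 0 by rewrite gt_eqF.
have chG : above_chords G.
  pose b := \sum_(i in S1) (mu 0 i)%:~R * a 0 i.
  have -> : G = (fun y => f (b + y)) by apply/funext => y; rewrite addrC.
  exact/above_chords_shift/concave_above_chords.
have ch : above_chords phi by exact/above_chords_sub_affine/above_chords_shift.
have cA : c + A = k%:~R * A by rewrite /c intrB; ring.
have phi0 : phi 0 = 0 by rewrite /phi addr0; ring.
have phiA : phi A = 0 by rewrite /phi divfK// cA /r /rho -/A -/c -/G; ring.
(* Since [c] is [k - 1] periods, [x] corresponds to translating [d] by [x - k + 1] periods; the
   linear term is independent of [x]. *)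
have valE (d : R) (x : int) :
    g f a mu S1 (d + A * x%:~R) - r * (x - k)%:~R - g f a mu S1 (k%:~R * A) =
    phi (d + (x - k + 1)%:~R * A) + r / A * d.
  have rE : G (k%:~R * A) = r + G c by rewrite /r /rho -/A -/c -/G; ring.
  rewrite -/G rE /phi.
  have -> : c + (d + (x - k + 1)%:~R * A) = d + A * x%:~R.
    by rewrite /c !intrD !intrN; ring.
  by rewrite !intrD !intrN; field.
pose m (d : R) : int := - Num.floor (d / A).
pose u (d : R) := d + (m d)%:~R * A.
have u_ge0 d : 0 <= u d.
  have := floor_itv (d / A); rewrite ler_pdivlMr// => /andP[+ _].
  by rewrite /u /m intrN; lra.
have u_lt d : u d < A.
  have := floor_itv (d / A); rewrite ltr_pdivrMr// => /andP[_].
  by rewrite /u /m intrN intrD; lra.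
have value_u d : Z_values f a mu s S1 k d (phi (u d) + r / A * d).
  (* The witness solves [x - k + 1 = m d]. *)
  exists (m d + k - 1) => //.
  by rewrite valE; congr (phi (_ + _%:~R * _) + _); ring.
have attained d : maximums (Z_values f a mu s S1 k d) (Z f a mu s S1 k d).
  (* Exhibiting a greatest element rules out the default value 0 of [xget]. *)
  apply: xgetPex; exists (phi (u d) + r / A * d); split; first exact: value_u.
  move=> _ [x _ <-]; rewrite valE lerD2r.
  have -> : d + (x - k + 1)%:~R * A = u d + (x - k + 1 - m d)%:~R * A.
    by rewrite /u !intrD !intrN; ring.
  exact: translate_le_representative.
have Z_ge d : phi (u d) + r / A * d <= Z f a mu s S1 k d.
  exact: (attained d).2 (value_u d).
(* Take [x] attaining the maximum at [d1 + d2]; the linear terms are additive and cancel, which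
   leaves an inequality for [phi] alone. *)
split=> // d1 d2; have [[x _ <-] _] := attained (d1 + d2).
rewrite valE; apply: le_trans (lerD (Z_ge d1) (Z_ge d2)).
have := translate_subadditive phi A ch as_gt0 phi0 phiA
  (u d1) (u d2) (x - k + 1 - m d1 - m d2)
  (u_ge0 d1) (u_lt d1) (u_ge0 d2) (u_lt d2).
have -> : u d1 + u d2 + (x - k + 1 - m d1 - m d2)%:~R * A =
          d1 + d2 + (x - k + 1)%:~R * A.
  by rewrite /u !intrD !intrN; ring.
by lra.
Qed.
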